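(* Let $d,k\in\mathbb N$ with $1\le k\le d$ and let $t,s\in\mathbb N$. Assume that the finite set $D\subset G_{k,d}$ is an equal-weight tight $t$-fusion frame, and that for each $V\in D$, $Y_V\subset S(V)$ is a spherical $s$-design, with $|Y_V|$ independent of $V$. Let $Z:=\bigcup_{V\in D}Y_V\subset S^{d-1}$, viewed as a multiset (a point is counted once for each $V\in D$ with the point in $Y_V$). Then the multiset $Z$ is a spherical $\min\{s,\,2t+1\}$-design on $S^{d-1}$.
   Context: $\mathbb N=\{1,2,\dots\}$. $S^{d-1}=\{x\in\mathbb R^d:\|x\|=1\}$ with normalized (probability) surface measure $\sigma$. $G_{k,d}$ is the set of $k$-dimensional linear subspaces of $\mathbb R^d$. For $V\in G_{k,d}$, $S(V)=\{x\in V:\|x\|=1\}\simeq S^{k-1}$, and $P_V$ is the orthogonal projection of $\mathbb R^d$ onto $V$. Equal-weight tight $t$-fusion frame: a finite set $D\subset G_{k,d}$ for which there is a constant $A>0$ with $\sum_{V\in D}\|P_Vx\|^{2t}=A\|x\|^{2t}$ for all $x\in\mathbb R^d$. Spherical $t$-design on $S^{d-1}$: a finite set (or finite multiset, with points counted with multiplicity) $\{x_1,\dots,x_n\}$, $n\ge1$, of points of $S^{d-1}$ such that $\int_{S^{d-1}}f\,d\sigma=\frac1n\sum_{j=1}^nf(x_j)$ for every polynomial function $f:\mathbb R^d\to\mathbb R$ of total degree at most $t$. A spherical $s$-design on $S(V)$ is defined in the same way after identifying $V$ isometrically with $\mathbb R^k$. *)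

(* Defs.v *)
From HB Require Import structures.
From mathcomp Require Import all_boot all_order all_algebra.
From mathcomp Require Import finmap multiset.
(* The notations of mpoly clash with those of mathcomp-analysis. *)
From mathcomp Require Import -(notations) mpoly.
From mathcomp Require Import all_classical all_reals all_analysis.
From mathcomp Require Import measurable_realfun.
From mathcomp Require Import lra.

Set Implicit Arguments.
Unset Strict Implicit.
Unset Printing Implicit Defensive.

Import Order.TTheory GRing.Theory Num.Theory.
Import numFieldNormedType.Exports.

Local Open Scope classical_set_scope.
Local Open Scope ring_scope.

(* The norm which 'rV[R]_n carries in mathcomp-analysis is the sup norm.  The
   Euclidean norm is defined on coordinate functions, so that it applies to
   row vectors (as [x 0]) and to tuples (as [tnth x]). *)
Definition enorm (R : realType) (n : nat) (v : 'I_n -> R) : R :=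
  Num.sqrt (\sum_i v i ^+ 2).

(* R^n with its Borel sigma-algebra, i.e., the product sigma-algebra that the
   library puts on tuples. *)
Notation Rn R n := (n.-tuple (measurableTypeR R)).

(* The library's [pushforward], with the measurability proof as an argument so
   that its measure structure can be inferred. *)
Definition image_measure d1 d2 (T1 : measurableType d1) (T2 : measurableType d2)
    (R : realType) (m : {measure set T1 -> \bar R}) (f : T1 -> T2)
    (mf : measurable_fun [set: T1] f) : set T2 -> \bar R :=
  pushforward m f.

HB.instance Definition _ d1 d2 (T1 : measurableType d1)
    (T2 : measurableType d2) (R : realType) (m : {measure set T1 -> \bar R})
    (f : T1 -> T2) (mf : measurable_fun [set: T1] f) :=
  Measure.copy (image_measure m mf)
    (measure_function_pushforward__canonical__measure_function_Measure m mf).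

Section lebesgue_measure_Rn.
Variable R : realType.

Definition consR n (p : measurableTypeR R * Rn R n) : Rn R n.+1 :=
  [tuple of p.1 :: p.2].

Lemma measurable_consR n : measurable_fun [set: _] (@consR n).
Proof. exact: measurable_cons. Qed.

Fixpoint lebesgue_Rn n : {measure set (Rn R n) -> \bar R} :=
  if n is n'.+1 then
    image_measure (lebesgue_measure \x^ lebesgue_Rn n')%E (@measurable_consR n')
  else dirac ([tuple] : Rn R 0).

End lebesgue_measure_Rn.

Section sphere_measure.
Variables (R : realType) (n : nat).

Lemma measurable_enorm : measurable_fun [set: Rn R n] (fun x => enorm (tnth x)).
Proof.
apply: (@measurableT_comp _ _ _ _ _ _ (@Num.sqrt R)).
  by apply: continuous_measurable_fun; exact: sqrt_continuous.
apply: measurable_sum => i; apply: measurable_funX; exact: measurable_tnth.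
Qed.

Definition unit_ball : set (Rn R n) := [set x | enorm (tnth x) <= 1].

Definition unit_sphere : set (Rn R n) := [set x | enorm (tnth x) = 1].

Lemma measurable_unit_ball : measurable unit_ball.
Proof.
have -> : unit_ball = [set: Rn R n] `&` (fun x => enorm (tnth x)) @^-1` `]-oo, 1].
  by rewrite setTI; apply/seteqP; split => x /=; rewrite in_itv.
exact: measurable_enorm.
Qed.

Definition radial (x : Rn R n) : Rn R n :=
  [tuple tnth x i / enorm (tnth x) | i < n].

Lemma measurable_radial : measurable_fun [set: Rn R n] radial.
Proof.
apply/measurable_fun_tnthP => i.
rewrite (_ : _ \o _ = fun x : Rn R n => tnth x i * enorm (tnth x) `^ (-1)).
  apply: measurable_funM; first exact: measurable_tnth.
  by apply: (measurableT_comp (measurable_powR _)); exact: measurable_enorm.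
by apply/funext => x /=; rewrite tnth_mktuple powR_inv1 ?sqrtr_ge0.
Qed.

Lemma unit_ball_inv_ge0 : 0 <= (fine (lebesgue_Rn R n unit_ball))^-1.
Proof. by rewrite invr_ge0 fine_ge0. Qed.

(* The normalized surface measure of the sphere, in polar coordinates: the
   measure of A is the proportion of the unit ball which is taken by the cone
   {r u : 0 < r <= 1, u \in A}. *)
Definition sphere_measure : set (Rn R n) -> \bar R :=
  mscale (NngNum unit_ball_inv_ge0)
    (image_measure (mrestr (lebesgue_Rn R n) measurable_unit_ball)
       measurable_radial).

HB.instance Definition _ := Measure.on sphere_measure.

Definition sphere_integral (f : ('I_n -> R) -> R) : R :=
  \int[sphere_measure]_(x in unit_sphere) f (tnth x).

End sphere_measure.

Section sphere_measure_normalized.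
Variable R : realType.

Let box n (r : R) : set (Rn R n) := [set x | forall i, - r <= tnth x i <= r].

Let boxS n r : @consR R n @^-1` box r = `[- r, r]%classic `*` box r.
Proof.
apply/seteqP; split => -[a x] /=.
  move=> ax; split => [|i]; first by have := ax ord0; rewrite in_itv.
  by have := ax (lift ord0 i); rewrite tnthS.
case; rewrite in_itv/= => ar xr i.
have [->|i0] := eqVneq i ord0; first by [].
by case: (unliftP ord0 i) => [j ->|/eqP]; [rewrite tnthS|rewrite (negbTE i0)].
Qed.

Let measurable_box n r : measurable (@box n r).
Proof.
have -> : @box n r = \bigcap_(i in [set: 'I_n])
    ((fun x : Rn R n => tnth x i) @^-1` `[- r, r]%classic).
  apply/seteqP; split => x /= xr i; last first.
    by have := xr i I; rewrite /= in_itv.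
  by move=> _ /=; rewrite in_itv/=.
apply: fin_bigcap_measurable => // i _.
by rewrite -[X in measurable X]setTI; exact: measurable_tnth.
Qed.

Let lebesgue_box n r : 0 <= r -> lebesgue_Rn R n (box r) = ((r *+ 2) ^+ n)%:E.
Proof.
move=> r0; elim: n => [|n ih].
  by rewrite /= diracE mem_set// => -[].
transitivity ((lebesgue_measure \x^ lebesgue_Rn R n)%E (@consR R n @^-1` box r)).
  by [].
rewrite boxS product_measure2E//; last exact: measurable_box.
rewrite ih exprS EFinM; congr (_ * _)%E.
apply: (etrans (lebesgue_measure_itv `[- r, r])); rewrite /= lte_fin.
case: ltP => [_|rr]; first by rewrite -EFinB opprK mulr2n.
have -> : r = 0 by lra.
by rewrite mul0rn.
Qed.

Let enorm0P n (x : Rn R n) : enorm (tnth x) = 0 -> forall i, tnth x i = 0.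
Proof.
move=> /eqP; rewrite sqrtr_eq0 => x0 i; apply/eqP; rewrite -sqrf_eq0.
have : \sum_i tnth x i ^+ 2 == 0.
  by rewrite eq_le x0 sumr_ge0// => j _; exact: sqr_ge0.
by rewrite psumr_eq0 => [/allP/(_ i (mem_index_enum i))//|j _]; exact: sqr_ge0.
Qed.

Let enorm_radial n (x : Rn R n) : enorm (tnth x) != 0 ->
  enorm (tnth (radial x)) = 1.
Proof.
move=> x0; rewrite /enorm.
under eq_bigr do rewrite tnth_mktuple expr_div_n.
rewrite -mulr_suml sqr_sqrtr; last by apply: sumr_ge0 => i _; exact: sqr_ge0.
rewrite divff ?sqrtr1//; apply: contra x0 => /eqP.
by rewrite /enorm => ->; rewrite sqrtr0.
Qed.

Lemma sphere_measure_unit_sphere n : (0 < n)%N ->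
  @sphere_measure R n (@unit_sphere R n) = 1%E.
Proof.
move=> n0.
set mu := lebesgue_Rn R n.
have mB := @measurable_unit_ball R n.
have box1 : @unit_ball R n `<=` box 1.
  move=> x; rewrite /unit_ball/= => x1 i; rewrite -ler_norml -sqrtr_sqr.
  apply: le_trans x1; apply: ler_wsqrtr; rewrite (bigD1 i)//= lerDl.
  by apply: sumr_ge0 => j _; exact: sqr_ge0.
have boxn : box (n%:R^-1) `<=` @unit_ball R n.
  move=> x /= xn; rewrite /unit_ball/= -sqrtr1; apply: ler_wsqrtr.
  apply: (@le_trans _ _ (\sum_(i < n) n%:R^-1)); last first.
    by rewrite sumr_const card_ord -[X in X <= _]mulr_natr mulVf// pnatr_eq0 -lt0n.
  apply: ler_sum => i _; have := xn i; rewrite -ler_norml => xi.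
  rewrite -real_normK ?num_real// expr2 -[leRHS]mulr1.
  apply: ler_pM => //; apply: (le_trans xi).
  by rewrite invf_le1 ?ler1n ?ltr0n.
have muoo : (mu (@unit_ball R n) < +oo)%E.
  apply: (@le_lt_trans _ _ (mu (box 1))).
    by apply: le_measure => //; rewrite inE//; exact: measurable_box.
  by rewrite /mu lebesgue_box// ltry.
have mu0 : (0 < mu (@unit_ball R n))%E.
  apply: (@lt_le_trans _ _ (mu (box n%:R^-1))).
    rewrite /mu lebesgue_box ?invr_ge0// lte_fin exprn_gt0//.
    by rewrite mulrn_wgt0// invr_gt0 ltr0n.
  by apply: le_measure => //; rewrite inE//; exact: measurable_box.
have muB0 : mu (@unit_ball R n `\` box 0) = mu (@unit_ball R n).
  have muDI : (mu (@unit_ball R n) = mu (@unit_ball R n `\` box 0) +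
      mu (@unit_ball R n `&` box 0))%E := measureDI mu mB (measurable_box 0).
  rewrite [RHS]muDI (_ : mu (@unit_ball R n `&` box 0) = 0%E) ?adde0//.
  apply/eqP; rewrite -measure_le0.
  have box00 : mu (box 0) = 0%E.
    by rewrite /mu lebesgue_box// mul0rn expr0n gtn_eqF.
  rewrite -box00; apply: le_measure; rewrite ?inE.
  - by apply: measurableI => //; exact: measurable_box.
  - exact: measurable_box.
  - exact: subIsetr.
rewrite /sphere_measure /mscale /= /image_measure /pushforward /mrestr -/mu.
rewrite (_ : _ `&` _ = @unit_ball R n `\` box 0).
  rewrite muB0 -[X in (_ * X)%E]fineK; last by rewrite ge0_fin_numE.
  by rewrite -EFinM mulVf// gt_eqF// fine_gt0// mu0.
apply/seteqP; split => x [] /= x1 x2; split => //.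
- move=> x0; move: x1; rewrite /unit_sphere/= /enorm big1 ?sqrtr0.
    by move=> /eqP; rewrite eq_sym oner_eq0.
  move=> i _; rewrite tnth_mktuple; have := x0 i; rewrite oppr0 => /le_anti <-.
  by rewrite mul0r expr0n.
- apply: enorm_radial; apply/eqP => /enorm0P x0; apply: x2 => i.
  by rewrite x0 oppr0 lexx.
Qed.

End sphere_measure_normalized.

Section designs.
Variable R : realType.

Definition spherical_design n (s : nat) (X : {mset 'rV[R]_n}%mset) : Prop :=
  [/\ (0 < size X)%N,
      forall x, x \in X -> enorm (x 0) = 1
    & forall p : mpoly n R, (msize p <= s.+1)%N ->
        sphere_integral (fun v => meval v p) =
        (size X)%:R^-1 * \sum_(x <- X) meval (x 0) p].

Definition mset_of_fset (K : choiceType) (A : {fset K}) : {mset K}%mset :=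
  seq_mset A.

Definition linear_isometry k d (f : 'Hom('rV[R]_k, 'rV[R]_d)) : Prop :=
  forall u, enorm (f u 0) = enorm (u 0).

(* X is a spherical design on S(V), V being identified with R^k by some linear
   isometry f; the choice of f is immaterial. *)
Definition subspace_design d k (s : nat) (V : {vspace 'rV[R]_d})
    (X : {mset 'rV[R]_d}%mset) : Prop :=
  exists f : 'Hom('rV[R]_k, 'rV[R]_d),
    [/\ linear_isometry f, limg f = V
      & exists2 X0 : {mset 'rV[R]_k}%mset, spherical_design s X0 &
          X = seq_mset [seq f u | u <- X0]].

Definition dotp d (u v : 'rV[R]_d) : R := \sum_i u 0 i * v 0 i.

Lemma dotp_is_linear d (u : 'rV[R]_d) : linear (dotp u : 'rV[R]_d -> R^o).
Proof.
move=> a v w; rewrite /dotp scaler_sumr -big_split/=; apply: eq_bigr => i _.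
by rewrite !mxE mulrDr mulrCA.
Qed.

Lemma dotpC d (u v : 'rV[R]_d) : dotp u v = dotp v u.
Proof. by apply: eq_bigr => i _; rewrite mulrC. Qed.

HB.instance Definition _ d (u : 'rV[R]_d) :=
  GRing.isLinear.Build R 'rV[R]_d R^o _ (dotp u : 'rV[R]_d -> R^o)
    (dotp_is_linear u).

Definition orthov d (V : {vspace 'rV[R]_d}) : {vspace 'rV[R]_d} :=
  (\bigcap_(i < \dim V)
     lker (linfun (dotp (vbasis V)`_i : 'rV[R]_d -> R^o)))%VS.

Lemma orthovP d (V : {vspace 'rV[R]_d}) (u : 'rV[R]_d) :
  reflect (forall v, v \in V -> dotp v u = 0) (u \in orthov V).
Proof.
apply: (iffP idP) => [+ v|uV].
  rewrite memvE => /subv_bigcapP uV /coord_vbasis ->.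
  rewrite dotpC linear_sum big1// => i _.
  rewrite linearZ/= dotpC.
  by have := uV i isT; rewrite -memvE memv_ker lfunE/= => /eqP ->; rewrite scaler0.
rewrite memvE; apply/subv_bigcapP => i _.
rewrite -memvE memv_ker lfunE/= uV// vbasis_mem// mem_nth//.
by rewrite size_tuple.
Qed.

Lemma dotp_eq0 d (u : 'rV[R]_d) : dotp u u = 0 -> u = 0.
Proof.
move/eqP; rewrite psumr_eq0 => [/allP u0|i _]; last by rewrite -expr2 sqr_ge0.
apply/rowP => i; rewrite mxE; apply/eqP.
by have := u0 i (mem_index_enum i); rewrite mulf_eq0 orbb.
Qed.

Lemma capv_orthov d (V : {vspace 'rV[R]_d}) : (V :&: orthov V = 0)%VS.
Proof.
apply/eqP; rewrite -subv0; apply/subvP => u.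
by rewrite memv_cap memv0 => /andP[uV /orthovP/(_ _ uV)/dotp_eq0 ->].
Qed.

Lemma addv_orthov d (V : {vspace 'rV[R]_d}) : (V + orthov V = fullv)%VS.
Proof.
pose h (x : 'rV[R]_d) : 'rV[R]_(\dim V) := \row_i dotp (vbasis V)`_i x.
have hlin : linear h.
  move=> a x y; apply/rowP => i; rewrite !mxE linearD linearZ/=.
  by [].
pose hL := GRing.isLinear.Build _ _ _ _ h hlin.
pose H : {linear 'rV[R]_d -> 'rV[R]_(\dim V)} := HB.pack h hL.
have kerH : (lker (linfun H) <= orthov V)%VS.
  apply/subvP => x; rewrite memv_ker lfunE/= => /eqP/rowP Hx.
  rewrite memvE; apply/subv_bigcapP => i _.
  by rewrite -memvE memv_ker lfunE/=; have := Hx i; rewrite !mxE => ->.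
apply/eqP; rewrite eqEdim subvf/=.
rewrite (dimv_disjoint_sum (capv_orthov V)).
rewrite -(limg_ker_dim (linfun H) fullv) capfv addnC leq_add//; last first.
  by apply: dimvS.
rewrite (leq_trans (dimvS (subvf _)))// dimvf /dim/= mul1n//.
Qed.

(* The library's [projv V] projects along an unspecified complement of V. *)
Definition orthoproj d (V : {vspace 'rV[R]_d}) : 'End('rV[R]_d) :=
  daddv_pi V (orthov V).

Lemma orthoprojP d (V : {vspace 'rV[R]_d}) (x y : 'rV[R]_d) :
  y = orthoproj V x <->
  y \in V /\ (forall v, v \in V -> dotp v (x - y) = 0).
Proof.
have VVo := capv_orthov V.
have xE : orthoproj V x + daddv_pi (orthov V) V x = x.
  by apply: daddv_pi_add => //; rewrite addv_orthov memvf.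
split=> [->|[yV /orthovP xyV]].
  split; first exact: memv_pi.
  by apply/orthovP; rewrite -{1}xE addrC addKr memv_pi.
suff : y - orthoproj V x \in (V :&: orthov V)%VS.
  by rewrite VVo memv0 subr_eq0 => /eqP.
rewrite memv_cap rpredB ?memv_pi//=.
have -> : y - orthoproj V x = (x - orthoproj V x) - (x - y).
  by rewrite opprB [RHS]addrC addrA subrK.
by rewrite rpredB// -{1}xE addrC addKr memv_pi.
Qed.

Definition tight_fusion_frame d k (t : nat) (D : {fset {vspace 'rV[R]_d}}) :
    Prop :=
  (forall V, V \in D -> \dim V = k) /\
  exists2 A : R, 0 < A & forall x : 'rV[R]_d,
    \sum_(V <- D) enorm (orthoproj V x 0) ^+ (2 * t) = A * enorm (x 0) ^+ (2 * t).

End designs.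

(* Main.v *)
Require Import Defs.
From HB Require Import structures.
From mathcomp Require Import all_boot all_order all_algebra.
From mathcomp Require Import finmap multiset.
From mathcomp Require Import -(notations) mpoly.
From mathcomp Require Import all_classical all_reals all_analysis.
From mathcomp Require Import measurable_realfun ring lra.
Import Order.TTheory GRing.Theory Num.Theory.
Local Open Scope ring_scope.

Set Implicit Arguments.
Unset Strict Implicit.
Unset Printing Implicit Defensive.

(** Averaging over the multiset union Z amounts to averaging, over the
subspaces V of the frame, the means over the designs Y_V.  On a polynomial of
degree at most s the mean over Y_V is the mean over the sphere S(V), so what
has to be shown is that the means over the spheres S(V), averaged over the
frame, reproduce the mean over the big sphere in degree at most 2t + 1
([fusion_frame_cubature]).

By linearity one may consider a monomial.  In odd degree all means vanish,
since the sphere measure is invariant under x |-> -x ([sphere_mean_odd]).  In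
even degree 2j <= 2t, multiplication by |x|^(2(t-j)), which is 1 on the unit
spheres, raises the degree to exactly 2t.  In that degree the powers <y,x>^(2t)
of linear forms span the homogeneous polynomials ([scalar_eq0_dhomog]), and on
such a power both sides are multiples of |y|^(2t):

- the mean of <y,x>^(2t) over the big sphere is c |y|^(2t), because the sphere
  measure is rotation invariant ([sphere_mean_even_power]);
- on S(V) the form <y,.> is represented by the projection of y on V, so the
  mean there is c' |P_V y|^(2t) ([sphere_mean_pullback_power]), and these add
  up to c' A |y|^(2t) by the frame identity.

So the two functionals are proportional on homogeneous polynomials of degree
2t, and their values on |x|^(2t) give the factor ([scalar_proportional]); the
constants c and c' never have to be computed.

Rotation invariance is needed only for rotations in a plane that contains the
first coordinate axis, which is enough to turn any vector y onto that axis.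
Such a rotation is a product of three shears, and a shear preserves Lebesgue
measure by Fubini and the invariance of Lebesgue measure under translations. *)

(** * Homogeneous polynomials and powers of linear forms *)

Definition mvar (R : nzRingType) n (i : 'I_n) : mpoly n R := mpolyX R (mnm1 i).
Arguments mvar {R n} i.

Definition lform (R : nzRingType) n (y : 'I_n -> R) : mpoly n R :=
  \sum_i y i *: mvar i.

Lemma horner_eq0_poly0 (R : numDomainType) (p : {poly R}) :
  (forall c, p.[c] = 0) -> p = 0.
Proof.
move=> p0; apply: (@roots_geq_poly_eq0 R p [seq i%:R | i <- iota 0 (size p)]).
- by apply/allP => c _; rewrite /root p0.
- by rewrite map_inj_uniq ?iota_uniq// => i j /eqP; rewrite eqr_nat => /eqP.
- by rewrite size_map size_iota.
Qed.

Section span.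
Variables (R : numFieldType) (n : nat).
Implicit Types (L : {scalar mpoly n R}).

(** For fixed linear forms l and x_i, L ((l + c x_i)^(m+1)) is a polynomial in
the scalar c that vanishes identically; its coefficient of degree 1 is
(m+1) L (x_i l^m). *)
Lemma polarization_step L m i (y : 'I_n -> R) :
  (forall z, L (lform z ^+ m.+1) = 0) -> L (mvar i * lform y ^+ m) = 0.
Proof.
move=> L0.
pose P := \poly_(j < m.+2)
  (L (lform y ^+ (m.+1 - j) * mvar i ^+ j) *+ 'C(m.+1, j)).
have P0 : P = 0.
  apply: horner_eq0_poly0 => c.
  have := L0 (fun j => y j + (if j == i then c else 0)).
  rewrite (_ : lform _ = lform y + c *: mvar i); last first.
    rewrite /lform; under eq_bigr do rewrite scalerDl.
    rewrite big_split/=; congr (_ + _); rewrite (bigD1 i)//= eqxx big1 ?addr0//.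
    by move=> j /negbTE ->; rewrite scale0r.
  rewrite exprDn linear_sum/= => L0c; apply: etrans L0c.
  rewrite horner_poly; apply: eq_bigr => j _.
  by rewrite linearMn exprZn -scalerAr linearZ/= mulrnAl mulrC.
have := congr1 (fun p : {poly R} => p`_1) P0.
rewrite coef_poly coef0/= subn1/= bin1 expr1 => /eqP.
by rewrite mulrn_eq0/= mulrC => /eqP.
Qed.

(** Induction on the degree: if X^a = x_i X^b, the functional q |-> L (x_i q)
again vanishes on powers of linear forms, by polarization. *)
Lemma scalar_eq0_mpolyX L m (a : multinom n) :
  mdeg a = m -> (forall y, L (lform y ^+ m) = 0) -> L (mpolyX R a) = 0.
Proof.
elim: m a L => [|m ih] a L.
  move=> /eqP; rewrite mdeg_eq0 => /eqP -> /(_ (fun=> 0)).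
  by rewrite expr0 mpolyX0.
move=> am L0.
have [i ai] : exists i, (0 < a i)%N.
  apply/existsP; apply: contraTT isT => /existsPn a0.
  suff : mdeg a = 0%N by rewrite am.
  by rewrite mdegE big1// => i _; apply/eqP; rewrite -leqn0 leqNgt a0.
pose b := mnm_sub a (mnm1 i).
have ab : a = mnm_add (mnm1 i) b.
  apply/mnmP => j; rewrite mnmDE mnmBE mnm1E; case: eqP => [<-|_].
    by rewrite subnKC.
  by rewrite add0n subn0.
pose L' q := L (mvar i * q).
have L'lin : scalar L'.
  by move=> c p q; rewrite /L' mulrDr -scalerAr linearD linearZ.
pose L'L := GRing.isLinear.Build _ _ _ _ L' L'lin.
pose LL : {scalar mpoly n R} := HB.pack L' L'L.
rewrite ab mpolyXD; apply: (ih b LL).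
  by apply/eqP; rewrite -eqSS -am ab mdegD mdeg1.
by move=> y; exact: polarization_step.
Qed.

(** Powers of linear forms span the homogeneous polynomials of their degree;
the dual form is the one that applies directly to integrals. *)
Lemma scalar_eq0_dhomog L m (q : mpoly n R) :
  (forall y, L (lform y ^+ m) = 0) -> q \is ishomog1 m mdeg -> L q = 0.
Proof.
move=> L0 /dhomogP qm; rewrite (mpolyE q) linear_sum big_seq big1// => a aq.
by rewrite linearZ/= (@scalar_eq0_mpolyX _ m) ?mulr0//; exact: qm.
Qed.

(** The combination c2 L1 - c1 L2 kills all powers of linear forms, hence all
homogeneous polynomials of degree m.  Evaluation at p, where L2 is nonzero,
eliminates the constants and shows in passing that c2 is nonzero. *)
Lemma scalar_proportional L1 L2 m (g : ('I_n -> R) -> R) (c1 c2 : R)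
    (p : mpoly n R) :
  (forall y, L1 (lform y ^+ m) = c1 * g y) ->
  (forall y, L2 (lform y ^+ m) = c2 * g y) ->
  p \is ishomog1 m mdeg -> L2 p = 1 ->
  forall q, q \is ishomog1 m mdeg -> L1 q = L1 p * L2 q.
Proof.
move=> h1 h2 pm p1 q qm.
have h r : r \is ishomog1 m mdeg -> c2 * L1 r = c1 * L2 r.
  move=> rm.
  pose L r := c2 * L1 r - c1 * L2 r.
  have Llin : scalar L by move=> c u v; rewrite /L !linearD !linearZ/=; ring.
  pose LL' := GRing.isLinear.Build _ _ _ _ L Llin.
  pose LL : {scalar mpoly n R} := HB.pack L LL'.
  apply/eqP; rewrite -subr_eq0; apply/eqP.
  by apply: (@scalar_eq0_dhomog LL m) => // y; rewrite /= /L h1 h2 mulrCA subrr.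
have c20 : c2 != 0.
  apply/eqP => c20.
  have : L2 p = 0.
    by apply: (@scalar_eq0_dhomog _ m) => // y; rewrite h2 c20 mul0r.
  by rewrite p1 => /eqP; rewrite oner_eq0.
by apply: (mulfI c20); rewrite (h q)// mulrA (h p)// p1 mulr1.
Qed.

Lemma eq_scalar_msupp L1 L2 p :
  (forall m, m \in msupp p -> L1 (mpolyX R m) = L2 (mpolyX R m)) -> L1 p = L2 p.
Proof.
move=> L12; rewrite (mpolyE p) !linear_sum; apply: eq_big_seq => m mp.
by rewrite !linearZ/= L12.
Qed.

Lemma msize_dhomog (p : mpoly n R) e :
  p \is ishomog1 e mdeg -> (mmeasure mdeg p <= e.+1)%N.
Proof.
move=> /dhomogP pe; rewrite mmeasureE big_seq.
apply: (big_ind (fun b => b <= e.+1)%N) => // [a b ae be|m /pe ->//].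
by rewrite geq_max ae.
Qed.

End span.

(** * Maps that preserve Lebesgue measure *)

Section preserves.
Local Open Scope classical_set_scope.

Definition preserves d (T : measurableType d) (R : realType)
    (m : set T -> \bar R) (f : T -> T) : Prop :=
  measurable_fun [set: T] f /\ forall A, measurable A -> m (f @^-1` A) = m A.

Lemma preserves_comp d (T : measurableType d) (R : realType)
    (m : set T -> \bar R) (f g : T -> T) :
  preserves m f -> preserves m g -> preserves m (f \o g).
Proof.
move=> [mf fm] [mg gm]; split; first exact: measurableT_comp.
move=> A mA; rewrite comp_preimage gm ?fm//.
by rewrite -[X in measurable X]setTI; exact: mf.
Qed.

End preserves.

Section product.
Local Open Scope classical_set_scope.
Context d1 d2 (T1 : measurableType d1) (T2 : measurableType d2) (R : realType).
Variable m1 : {sigma_finite_measure set T1 -> \bar R}.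
Variable m2 : {sigma_finite_measure set T2 -> \bar R}.

Lemma product_measure2_xsection A : measurable A ->
  (m1 \x^ m2)%E A = (\int[m1]_x m2 (xsection A x))%E.
Proof.
move=> mA; apply/esym.
pose m' : {measure set (T1 * T2) -> \bar R} := (m1 \x^ m2)%E.
apply: (@product_measure_unique _ _ _ _ _ m1 m2 m') => // B C mB mC.
exact: product_measure2E.
Qed.

(** A fibred map that preserves the measure of each fibre preserves the product
measure.  For maps over the second factor this is the definition of the product
measure by its sections. *)
Lemma preserves_shear1 (h : T2 -> T1 -> T1) :
  measurable_fun [set: T1 * T2] (fun p => h p.2 p.1) ->
  (forall y, preserves m1 (h y)) ->
  preserves (m1 \x^ m2)%E (fun p => (h p.2 p.1, p.2)).
Proof.
move=> mh hm; split; first exact/measurable_fun_pair.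
move=> A mA; apply: eq_integral => y _ /=.
rewrite -[RHS](hm y).2; last exact: measurable_ysection.
by congr (m1 _); apply/seteqP; split => x; rewrite /ysection/= !inE.
Qed.

(** Over the first factor the order of integration has to be exchanged. *)
Lemma preserves_shear2 (h : T1 -> T2 -> T2) :
  measurable_fun [set: T1 * T2] (fun p => h p.1 p.2) ->
  (forall x, preserves m2 (h x)) ->
  preserves (m1 \x^ m2)%E (fun p => (p.1, h p.1 p.2)).
Proof.
move=> mh hm.
have mf : measurable_fun [set: T1 * T2] (fun p => (p.1, h p.1 p.2)).
  exact/measurable_fun_pair.
split => // A mA; rewrite !product_measure2_xsection//; last first.
  by rewrite -[X in measurable X]setTI; exact: mf.
apply: eq_integral => x _ /=.
rewrite -[RHS](hm x).2; last exact: measurable_xsection.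
by congr (m2 _); apply/seteqP; split => y; rewrite /xsection/= !inE.
Qed.

End product.

Section lebesgue.
Local Open Scope classical_set_scope.
Variable R : realType.
Local Notation lambda := (@lebesgue_measure R).

Lemma preserves_addr (a : R) : preserves lambda (fun x => x + a).
Proof.
have ma : measurable_fun [set: measurableTypeR R]
    (fun x : measurableTypeR R => x + a : measurableTypeR R).
  exact: measurable_funD.
split => // A mA.
apply/esym.
apply: (lebesgue_measure_unique (mu := image_measure lambda ma)) => //.
move=> _ [[x y]] _ <-.
rewrite /= /image_measure /pushforward.
rewrite (_ : _ @^-1` _ = `]x - a, y - a]%classic); last first.
  by apply/seteqP; split => z /=; rewrite !in_itv/= ltrBlDr lerBrDr.
rewrite !lebesgue_measure_itv/= !lte_fin ltrD2r -!EFinB.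
by case: ifP => // _; congr EFin; ring.
Qed.

Lemma preserves_oppr : preserves lambda -%R.
Proof. by split => // A mA; exact: lebesgue_measureN. Qed.

Definition unconsR n (x : Rn R n.+1) : measurableTypeR R * Rn R n :=
  (thead x, [tuple of behead x]).

Lemma consRK n : cancel (@consR R n) (@unconsR n).
Proof. by case=> x w; congr pair; apply/val_inj. Qed.

Lemma unconsRK n : cancel (@unconsR n) (@consR R n).
Proof. by move=> x; rewrite [RHS]tuple_eta; exact/val_inj. Qed.

Lemma tnth_consR0 n p : tnth (@consR R n p) ord0 = p.1.
Proof. by []. Qed.

Lemma tnth_consRS n p i : tnth (@consR R n p) (lift ord0 i) = tnth p.2 i.
Proof. exact: tnthS. Qed.

Lemma measurable_unconsR n : measurable_fun [set: _] (@unconsR n).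
Proof.
apply/measurable_fun_pair; last exact: measurable_behead.
exact: measurable_tnth.
Qed.

Lemma sigma_finite_lebesgue_Rn n : sigma_finite [set: Rn R n] (lebesgue_Rn R n).
Proof.
elim: n => [|n ih].
  exists (fun=> setT); first by rewrite bigcup_const.
  by move=> k; split => //; rewrite /= diracT ltry.
have /sigma_finiteP[F [TF ndF Foo]] := sigma_finiteT lambda.
move: ih => /sigma_finiteP[G [TG ndG Goo]].
exists (fun k => @unconsR n @^-1` (F k `*` G k)).
  apply/esym/seteqP; split => // x _.
  have : [set: R] (unconsR x).1 by [].
  rewrite TF => -[i _ Fi].
  have : [set: Rn R n] (unconsR x).2 by [].
  rewrite TG => -[j _ Gj]; exists (maxn i j) => //; split.
    by move: Fi; exact/subsetPset/ndF/leq_maxl.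
  by move: Gj; exact/subsetPset/ndG/leq_maxr.
move=> k; have [mF Fk] := Foo k; have [mG Gk] := Goo k.
have mFG : measurable (F k `*` G k) by exact: measurableX.
split; first by rewrite -[X in measurable X]setTI; exact: measurable_unconsR.
rewrite /= /image_measure /pushforward -comp_preimage.
rewrite (_ : _ \o _ = id) ?preimage_id; last first.
  by apply/funext => x; exact: consRK.
by rewrite product_measure2E// lte_mul_pinfty// ge0_fin_numE.
Qed.

(** Lebesgue measure on R^n under a name that can carry the structure of a
sigma-finite measure. *)
Definition vol n : set (Rn R n) -> \bar R := lebesgue_Rn R n.
Arguments vol : clear implicits.
HB.instance Definition _ n := Measure.copy (vol n) (lebesgue_Rn R n).
HB.instance Definition _ n := @Measure_isSigmaFinite.Build _ _ R (vol n)
  (sigma_finite_lebesgue_Rn n).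

Local Notation RxRn n := (measurableTypeR R * Rn R n)%type.

Definition conj_consR n (F : RxRn n -> RxRn n) : Rn R n.+1 -> Rn R n.+1 :=
  @consR R n \o F \o @unconsR n.

Lemma preserves_conj_consR n F :
  preserves (lambda \x^ vol n)%E F -> preserves (vol n.+1) (@conj_consR n F).
Proof.
move=> [mF FE]; split.
  apply: (@measurableT_comp _ _ _ _ _ _ (@consR R n \o F)).
    by apply: measurableT_comp => //; exact: measurable_consR.
  exact: measurable_unconsR.
move=> A mA.
have mcA : measurable (@consR R n @^-1` A).
  by rewrite -[X in measurable X]setTI; exact: measurable_consR.
rewrite /vol /= /image_measure /pushforward -[RHS](FE _ mcA).
by congr (_ _); apply/seteqP; split => p; rewrite /conj_consR/= consRK.
Qed.

Definition coordwise n (h : 'I_n -> measurableTypeR R -> measurableTypeR R)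
    (x : Rn R n) : Rn R n := [tuple h i (tnth x i) | i < n].

Lemma measurable_coordwise n
    (h : 'I_n -> measurableTypeR R -> measurableTypeR R) :
  (forall i, measurable_fun [set: measurableTypeR R] (h i)) ->
  measurable_fun [set: Rn R n] (coordwise h).
Proof.
move=> mh; apply/measurable_fun_tnthP => i.
rewrite (_ : _ \o _ = h i \o (@tnth _ _ ^~ i)); last first.
  by apply/funext => x /=; rewrite tnth_mktuple.
by apply: measurableT_comp => //; exact: measurable_tnth.
Qed.

(** In particular translations and the antipodal map preserve Lebesgue measure
on R^n. *)
Lemma preserves_coordwise n
    (h : 'I_n -> measurableTypeR R -> measurableTypeR R) :
  (forall i, preserves lambda (h i)) -> preserves (vol n) (coordwise h).
Proof.
move=> hP; split; first by apply: measurable_coordwise => i; case: (hP i).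
elim: n => [|n ih] in h hP *.
  move=> A _; congr (vol _ _); apply/seteqP.
  by split=> x /=; rewrite (tuple0 x) (tuple0 (coordwise _ _)).
pose F1 (p : RxRn n) : RxRn n := (h ord0 p.1, p.2).
pose F2 (p : RxRn n) : RxRn n :=
  (p.1, coordwise (fun i => h (lift ord0 i)) p.2).
pose F := F1 \o F2.
suff FP : preserves (lambda \x^ vol n)%E F.
  move=> A mA; rewrite -[RHS](preserves_conj_consR FP).2//; congr (vol _ _).
  congr (_ @^-1` A); apply/funext => x.
  apply/eq_from_tnth => i; rewrite tnth_mktuple /conj_consR/=.
  case: (unliftP ord0 i) => [j|] ->.
    rewrite tnth_consRS/= tnth_mktuple.
    by rewrite -[X in tnth X (lift _ _)](unconsRK x) tnth_consRS.
  by rewrite tnth_consR0.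
apply: preserves_comp.
  apply: (@preserves_shear1 _ _ _ _ _ _ (vol n) (fun=> h ord0)) => //.
  apply: measurableT_comp => //=.
  by case: (hP ord0).
have ihP : preserves (vol n) (coordwise (fun i => h (lift ord0 i))).
  split; last by apply: ih => i; exact: hP.
  by apply: measurable_coordwise => i; case: (hP (lift ord0 i)).
apply: (@preserves_shear2 _ _ _ _ _ _ (vol n) (fun=> _)) => //.
apply: measurableT_comp => //.
by case: ihP.
Qed.

Definition dot n (u : 'I_n -> R) (w : Rn R n) : R := \sum_i u i * tnth w i.

Lemma measurable_dot n (u : 'I_n -> R) : measurable_fun [set: Rn R n] (dot u).
Proof.
apply: measurable_sum => i; apply: measurable_funM => //.
exact: measurable_tnth.
Qed.

Definition shear_up n (a : R) (u : 'I_n -> R) (p : RxRn n) : RxRn n :=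
  (p.1 + a * dot u p.2, p.2).

Definition shear_down n (b : R) (u : 'I_n -> R) (p : RxRn n) : RxRn n :=
  (p.1, coordwise (fun i y => y + b * p.1 * u i) p.2).

Lemma preserves_shear_up n a (u : 'I_n -> R) :
  preserves (lambda \x^ vol n)%E (shear_up a u).
Proof.
apply: (@preserves_shear1 _ _ _ _ _ _ (vol n)
  (fun (w : Rn R n) (x : measurableTypeR R) =>
     (x + a * dot u w : measurableTypeR R))).
  apply: measurable_funD; first exact: measurable_fst.
  apply: measurable_funM => //.
  by apply: measurableT_comp => //; exact: measurable_dot.
by move=> w; exact: preserves_addr.
Qed.

Lemma preserves_shear_down n b (u : 'I_n -> R) :
  preserves (lambda \x^ vol n)%E (shear_down b u).
Proof.
apply: (@preserves_shear2 _ _ _ _ _ _ (vol n)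
  (fun x : measurableTypeR R =>
     coordwise (fun i (y : measurableTypeR R) => y + b * x * u i))).
  apply/measurable_fun_tnthP => i.
  rewrite (_ : _ \o _ = fun p : RxRn n => tnth p.2 i + b * p.1 * u i).
    apply: measurable_funD.
      by apply: (measurableT_comp (measurable_tnth i)).
    by do 2 apply: measurable_funM => //; exact: measurable_fst.
  by apply/funext => x /=; rewrite tnth_mktuple.
by move=> x; apply: preserves_coordwise => i; exact: preserves_addr.
Qed.

(** For a unit vector u of R^n, the rotation with cosine c and sine s in the
plane of R x R^n that is spanned by (1, 0) and (0, u). *)
Definition rotation n (c s : R) (u : 'I_n -> R) (p : RxRn n) : RxRn n :=
  (c * p.1 - s * dot u p.2,
   [tuple tnth p.2 i + (s * p.1 + (c - 1) * dot u p.2) * u i | i < n]).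

(** In the plane of the rotation,
[[c, -s], [s, c]] = [[1, a], [0, 1]] [[1, 0], [s, 1]] [[1, a], [0, 1]]
with a = (c - 1) / s. *)
Lemma preserves_rotation n c s (u : 'I_n -> R) :
  \sum_i u i ^+ 2 = 1 -> c ^+ 2 + s ^+ 2 = 1 -> s != 0 ->
  preserves (lambda \x^ vol n)%E (rotation c s u).
Proof.
move=> u1 cs1 s0; pose a := (c - 1) / s.
have as_ : a * s = c - 1 by rewrite /a divfK.
have ac : a * (c + 1) = - s.
  apply: (mulIf s0); rewrite mulrAC as_; lra.
suff -> : rotation c s u = shear_up a u \o (shear_down s u \o shear_up a u).
  apply: preserves_comp; first exact: preserves_shear_up.
  apply: preserves_comp; first exact: preserves_shear_down.
  exact: preserves_shear_up.
apply/funext => -[x w]; rewrite /rotation /shear_up /shear_down/=.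
set p := dot u w.
have dotE t : dot u [tuple tnth w i + t * u i | i < n] = p + t.
  rewrite -[t in RHS]mulr1 -u1 mulr_sumr -big_split/=; apply: eq_bigr => i _.
  by rewrite tnth_mktuple; ring.
congr pair.
  rewrite dotE.
  have -> : x + a * p + a * (p + s * (x + a * p)) =
    (1 + a * s) * x + a * (a * s + 1 + 1) * p by ring.
  by rewrite as_ subrK ac; ring.
apply: eq_from_tnth => i; rewrite !tnth_mktuple; congr (_ + _ * _).
by rewrite -as_; ring.
Qed.

Lemma rotation_sqnorm n c s (u : 'I_n -> R) (p : RxRn n) :
  \sum_i u i ^+ 2 = 1 -> c ^+ 2 + s ^+ 2 = 1 ->
  let q := rotation c s u p in
  q.1 ^+ 2 + \sum_i tnth q.2 i ^+ 2 = p.1 ^+ 2 + \sum_i tnth p.2 i ^+ 2.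
Proof.
case: p => x w u1 cs1 /=; set p := dot u w; set t := s * x + (c - 1) * p.
rewrite (eq_bigr (fun i => tnth w i ^+ 2 +
    (2 * t * (u i * tnth w i) + t ^+ 2 * u i ^+ 2))).
  rewrite !big_split/= -!mulr_sumr u1 -/(dot u w) -/p.
  rewrite /t; nra.
by move=> i _; rewrite tnth_mktuple; ring.
Qed.

End lebesgue.
Arguments vol : clear implicits.

(** * Means of polynomials over the sphere *)

Arguments unit_sphere {R n}.
Arguments sphere_measure {R n}.

Section sphere.
Local Open Scope classical_set_scope.
Variable R : realType.

Definition scaleRn n (k : R) (x : Rn R n) : Rn R n :=
  [tuple k * tnth x i | i < n].

(** The properties of an orthogonal transformation from which the invariance of
the sphere measure follows. *)
Definition sphere_symmetry n (T : Rn R n -> Rn R n) : Prop :=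
  [/\ preserves (vol R n) T,
      forall x, enorm (tnth (T x)) = enorm (tnth x)
    & forall k x, T (scaleRn k x) = scaleRn k (T x)].

Lemma radialE n (x : Rn R n) : radial x = scaleRn (enorm (tnth x))^-1 x.
Proof. by apply: eq_from_tnth => i; rewrite !tnth_mktuple mulrC. Qed.

(** Such a map commutes with the radial projection and preserves both the unit
ball and its Lebesgue measure. *)
Lemma preserves_sphere_measure n (T : Rn R n -> Rn R n) :
  sphere_symmetry T -> preserves (@sphere_measure R n) T.
Proof.
move=> [[mT TE] Tnorm Tscale]; split => // A mA.
have radialT x : radial (T x) = T (radial x) by rewrite !radialE Tscale Tnorm.
have mrA : measurable (@radial R n @^-1` A `&` @unit_ball R n).
  apply: measurableI; last exact: measurable_unit_ball.
  by rewrite -[X in measurable X]setTI; exact: measurable_radial.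
rewrite /sphere_measure /mscale/= /image_measure /pushforward /mrestr.
congr (_ * _)%E; rewrite -[RHS](TE _ mrA); congr (lebesgue_Rn R n _).
by apply/seteqP; split => x; rewrite /unit_ball/= radialT Tnorm.
Qed.

Lemma measurable_unit_sphere n : measurable (@unit_sphere R n).
Proof.
rewrite (_ : @unit_sphere R n = [set: Rn R n] `&`
    (fun x => enorm (tnth x)) @^-1` [set 1]); last by rewrite setTI.
by apply: measurable_enorm => //; exact: measurable_set1.
Qed.

Lemma measurable_meval n (p : mpoly n R) :
  measurable_fun [set: Rn R n] (fun x => meval (tnth x) p).
Proof.
rewrite (_ : (fun _ => _) = fun x : Rn R n => \sum_(m <- msupp p)
    mcoeff m p * \prod_i tnth x i ^+ m i); last first.
  by apply/funext => x; rewrite mevalE.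
apply: measurable_sum => m; apply: measurable_funM => //.
apply: measurable_prod => i _; apply: measurable_funX; exact: measurable_tnth.
Qed.

Lemma unit_sphere_coord n (x : Rn R n) i : unit_sphere x -> `|tnth x i| <= 1.
Proof.
rewrite /unit_sphere/= => <-; rewrite -sqrtr_sqr; apply: ler_wsqrtr.
rewrite (bigD1 i)//= lerDl; apply: sumr_ge0 => j _; exact: sqr_ge0.
Qed.

(** The composition with T is there for the change of variables in
[sphere_mean_symmetry].  On the unit sphere the coordinates are at most 1 in
absolute value, which bounds a polynomial by the sum of the absolute values of
its coefficients. *)
Lemma integrable_meval n (p : mpoly n R) (T : Rn R n -> Rn R n) : (0 < n)%N ->
  measurable_fun [set: Rn R n] T ->
  (forall x, unit_sphere x -> unit_sphere (T x)) ->
  (@sphere_measure R n).-integrable unit_sphere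
    (fun x => (meval (tnth (T x)) p)%:E).
Proof.
move=> n0 mT TS.
apply: (@measurable_bounded_integrable _ _ _ _ (fun x => meval (tnth (T x)) p)).
- exact: measurable_unit_sphere.
- rewrite [X in (X < _)%E](_ : _ = 1%E) ?ltry//.
  exact: sphere_measure_unit_sphere.
- apply: measurable_funTS.
  by apply: (measurableT_comp (measurable_meval p)).
- exists (\sum_(m <- msupp p) `|mcoeff m p|); split; first exact: num_real.
  move=> M pM x Sx /=; apply: le_trans (ltW pM); rewrite mevalE.
  apply: le_trans (ler_norm_sum _ _ _) _; apply: ler_sum => m _.
  rewrite normrM ler_piMr// normr_prod; apply: prodr_ile1 => i _.
  rewrite normr_ge0/= normrX exprn_ile1//.
  by apply: unit_sphere_coord; exact: TS.
Qed.

Definition sphere_mean n (p : mpoly n R) : R :=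
  sphere_integral (fun v => meval v p).

Lemma sphere_mean_is_scalar n : (0 < n)%N -> scalar (@sphere_mean n).
Proof.
move=> n0 c p q; rewrite /sphere_mean /sphere_integral.
have mS := @measurable_unit_sphere n.
have ip r :=
  @integrable_meval n r id n0 (@measurable_id _ _ _) (fun x Sx => Sx).
under eq_Rintegral do rewrite mevalD mevalZ.
rewrite RintegralD//; first by rewrite RintegralZl//; exact: ip.
- have := ip (c *: p); congr (_.-integrable _ _).
  by apply/funext => x; rewrite mevalZ.
- exact: ip.
Qed.

Definition sphere_mean_scalar n (n0 : (0 < n)%N) : {scalar mpoly n R} :=
  HB.pack (@sphere_mean n)
    (GRing.isLinear.Build _ _ _ _ (@sphere_mean n)
       (sphere_mean_is_scalar n0)).

Lemma eq_sphere_mean n (p q : mpoly n R) :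
  (forall v, enorm v = 1 -> meval v p = meval v q) ->
  sphere_mean p = sphere_mean q.
Proof.
move=> pq; apply: eq_Rintegral => x; rewrite inE => Sx; exact: pq.
Qed.

Lemma sphere_mean1 n : (0 < n)%N -> sphere_mean (1 : mpoly n R) = 1.
Proof.
move=> n0; rewrite /sphere_mean /sphere_integral.
under eq_Rintegral do rewrite meval1.
rewrite Rintegral_cst; last exact: measurable_unit_sphere.
by rewrite mul1r [X in fine X](sphere_measure_unit_sphere R n0).
Qed.

Lemma sphere_mean_symmetry n (T : Rn R n -> Rn R n) (p q : mpoly n R) :
  (0 < n)%N -> sphere_symmetry T ->
  (forall x, meval (tnth (T x)) p = meval (tnth x) q) ->
  sphere_mean p = sphere_mean q.
Proof.
move=> n0 sT pq; have [_ Tnorm _] := sT.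
have [mT TE] := preserves_sphere_measure sT.
have TS x : unit_sphere x -> unit_sphere (T x) by rewrite /unit_sphere/= Tnorm.
rewrite /sphere_mean /sphere_integral /Rintegral; congr fine.
transitivity (\int[pushforward (@sphere_measure R n) T]_(x in unit_sphere)
    (meval (tnth x) p)%:E)%E.
  by apply: eq_measure_integral => A mA _ /=; rewrite -[LHS]TE.
rewrite integral_pushforward//.
- rewrite (_ : T @^-1` unit_sphere = unit_sphere).
    by apply: eq_integral => x _ /=; rewrite pq.
  by apply/seteqP; split => x; rewrite /unit_sphere/= Tnorm.
- by apply/measurable_EFinP; exact: measurable_meval.
- rewrite (_ : T @^-1` unit_sphere = unit_sphere).
    exact: integrable_meval.
  by apply/seteqP; split => x; rewrite /unit_sphere/= Tnorm.
- exact: measurable_unit_sphere.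
Qed.

Lemma unconsR_scaleRn n k (x : Rn R n.+1) :
  unconsR (scaleRn k x) = (k * (unconsR x).1, scaleRn k (unconsR x).2).
Proof.
rewrite -{1}(unconsRK x); case: (unconsR x) => a w /=.
rewrite -[RHS]consRK; congr unconsR; apply: eq_from_tnth => i.
rewrite tnth_mktuple; case: (unliftP ord0 i) => [j ->|->].
  by rewrite !tnth_consRS tnth_mktuple.
by rewrite !tnth_consR0.
Qed.

Lemma unconsR_conj_consR n F (x : Rn R n.+1) :
  unconsR (conj_consR F x) = F (unconsR x).
Proof. exact: consRK. Qed.

Lemma sum_sqr_unconsR n (x : Rn R n.+1) :
  \sum_i tnth x i ^+ 2 = (unconsR x).1 ^+ 2 + \sum_i tnth (unconsR x).2 i ^+ 2.
Proof.
rewrite -{1}(unconsRK x) big_ord_recl tnth_consR0; congr (_ + _).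
by apply: eq_bigr => i _; rewrite tnth_consRS.
Qed.

Lemma sphere_symmetry_rotation n c s (u : 'I_n -> R) :
  \sum_i u i ^+ 2 = 1 -> c ^+ 2 + s ^+ 2 = 1 -> s != 0 ->
  sphere_symmetry (conj_consR (rotation c s u)).
Proof.
move=> u1 cs1 s0; split.
- exact/preserves_conj_consR/preserves_rotation.
- move=> x; rewrite /enorm !sum_sqr_unconsR unconsR_conj_consR.
  by rewrite (rotation_sqnorm _ u1 cs1).
- move=> k x; apply: (can_inj (@unconsRK R n)).
  rewrite unconsR_scaleRn !unconsR_conj_consR unconsR_scaleRn.
  case: (unconsR x) => a w.
  have dotZ : dot u (scaleRn k w) = k * dot u w.
    rewrite /dot mulr_sumr; apply: eq_bigr => i _.
    by rewrite tnth_mktuple mulrCA.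
  congr pair.
    by rewrite /= dotZ; ring.
  by apply: eq_from_tnth => i; rewrite !tnth_mktuple/= dotZ; ring.
Qed.

Lemma sphere_symmetry_opp n : sphere_symmetry (@coordwise R n (fun=> -%R)).
Proof.
split.
- by apply: preserves_coordwise => i; exact: preserves_oppr.
- by move=> x; rewrite /enorm; under eq_bigr do rewrite tnth_mktuple sqrrN.
- by move=> k x; apply: eq_from_tnth => i; rewrite !tnth_mktuple mulrN.
Qed.

(** By invariance under x |-> -x. *)
Lemma sphere_mean_odd_mpolyX n (m : multinom n) : (0 < n)%N -> odd (mdeg m) ->
  sphere_mean (mpolyX R m) = 0.
Proof.
move=> n0 om.
have : sphere_mean (mpolyX R m) = sphere_mean (- mpolyX R m).
  apply: (sphere_mean_symmetry n0 (sphere_symmetry_opp n)) => x.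
  rewrite mevalN !mevalX.
  under eq_bigr do rewrite tnth_mktuple exprNn.
  by rewrite big_split/= -expr_sum -mdegE -signr_odd om expr1 mulN1r.
have /= -> := linearN (sphere_mean_scalar n0) (mpolyX R m); lra.
Qed.

Lemma sphere_mean_odd n (p : mpoly n R) e : (0 < n)%N -> odd e ->
  p \is ishomog1 e mdeg -> sphere_mean p = 0.
Proof.
move=> n0 oe /dhomogP pe; rewrite (mpolyE p).
rewrite -[sphere_mean _]/(sphere_mean_scalar n0 _) linear_sum big_seq.
rewrite big1// => m mp.
by rewrite linearZ/= sphere_mean_odd_mpolyX ?mulr0// (pe m mp).
Qed.

Lemma meval_lform n (y v : 'I_n -> R) : meval v (lform y) = \sum_i y i * v i.
Proof.
by rewrite raddf_sum/=; apply: eq_bigr => i _; rewrite mevalZ mevalXU.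
Qed.

(** A rotation T that takes the vector |y| e_0 to y turns <y, T x> into |y| x_0,
so the factor c is the mean of x_0^(2t). *)
Lemma sphere_mean_even_power n t : (0 < n)%N ->
  exists c : R, forall y : 'I_n -> R,
    sphere_mean (lform y ^+ (2 * t)) = c * (\sum_i y i ^+ 2) ^+ t.
Proof.
case: n => // n n0.
exists (sphere_mean (mvar (ord0 : 'I_n.+1) ^+ (2 * t))) => y.
set q := \sum_i _.
have qE : q = y ord0 ^+ 2 + \sum_i y (lift ord0 i) ^+ 2.
  by rewrite /q big_ord_recl.
suff [T sT yT] : exists2 T : Rn R n.+1 -> Rn R n.+1, sphere_symmetry T &
    forall x, (\sum_i y i * tnth (T x) i) ^+ 2 = q * tnth x ord0 ^+ 2.
  have qZ (p : mpoly n.+1 R) :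
      sphere_mean (q ^+ t *: p) = q ^+ t * sphere_mean p.
    by rewrite -[LHS]/(sphere_mean_scalar n0 _) linearZ.
  rewrite mulrC -qZ; apply: (sphere_mean_symmetry n0 sT) => x.
  by rewrite mevalZ !rmorphXn/= meval_lform mevalXU !exprM yT exprMn.
set a := y ord0 in qE *; set r2 := \sum_(i < n) _ in qE.
have r20 : 0 <= r2 by apply: sumr_ge0 => i _; exact: sqr_ge0.
(* If y lies on the first axis, even powers need no rotation, whatever the sign
   of a = y_0. *)
have [r2E|r2n0] := eqVneq r2 0.
  have y0 i : y (lift ord0 i) = 0.
    move/eqP: r2E; rewrite psumr_eq0 => [/allP/(_ i (mem_index_enum i))|j _].
      by rewrite sqrf_eq0 => /eqP.
    exact: sqr_ge0.
  exists id.
    split => //; split => //; exact: measurable_id.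
  move=> x; rewrite big_ord_recl big1 => [|i _]; last by rewrite y0 mul0r.
  by rewrite qE r2E !addr0 exprMn.
(* Otherwise y = (a, r u) with u a unit vector, and the rotation acts in the
   plane of the first axis and u, by the angle with cosine a / |y| and sine
   r / |y|. *)
pose r := Num.sqrt r2; pose rho := Num.sqrt q.
have r_gt0 : 0 < r by rewrite sqrtr_gt0 lt0r r2n0.
have q_gt0 : 0 < q by rewrite qE ltr_wpDl ?sqr_ge0// lt0r r2n0.
have rho_gt0 : 0 < rho by rewrite sqrtr_gt0.
have rE : r ^+ 2 = r2 by rewrite sqr_sqrtr.
have rhoE : rho ^+ 2 = q by rewrite sqr_sqrtr// ltW.
pose u i := y (lift ord0 i) / r.
have yu i : y (lift ord0 i) = r * u i by rewrite mulrC divfK// gt_eqF.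
have u1 : \sum_i u i ^+ 2 = 1.
  apply: (mulfI r2n0); rewrite mulr1 -{1}rE mulr_sumr; apply: eq_bigr => i _.
  by rewrite -exprMn -yu.
pose c := a / rho; pose s := r / rho.
have ac : a = rho * c by rewrite mulrC divfK// gt_eqF.
have rs : r = rho * s by rewrite mulrC divfK// gt_eqF.
have cs1 : c ^+ 2 + s ^+ 2 = 1.
  apply: (mulfI (lt0r_neq0 q_gt0)).
  by rewrite -{1}rhoE mulrDr -!exprMn -ac -rs rE -qE mulr1.
have s0 : s != 0 by rewrite mulf_neq0 ?invr_eq0 ?gt_eqF.
exists (conj_consR (rotation c s u)); first exact: sphere_symmetry_rotation.
move=> x; suff -> : \sum_i y i * tnth (conj_consR (rotation c s u) x) i =
    rho * tnth x ord0.
  by rewrite exprMn rhoE.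
rewrite -(unconsRK x); case: (unconsR x) => x0 w; rewrite tnth_consR0.
rewrite /conj_consR/comp consRK big_ord_recl !tnth_consR0 -/a.
set p := dot u w.
transitivity (a * (c * x0 - s * p) + r * (p + (s * x0 + (c - 1) * p) * 1)).
  congr (_ + _); rewrite -{2}u1 mulr_sumr /p {1}/dot -big_split mulr_sumr.
  apply: eq_bigr => i _; rewrite tnth_consRS/= tnth_mktuple yu -/p; ring.
rewrite ac rs.
transitivity (rho * x0 * (c ^+ 2 + s ^+ 2)); first by ring.
by rewrite cs1 mulr1.
Qed.

End sphere.

(** * Sums over multisets *)

Section multisets.
Local Open Scope mset_scope.
Variable K : choiceType.

Lemma perm_msetD (A B : {mset K}) : perm_eq (A `+` B) (A ++ B).
Proof.
by apply/allP => x _ /=; rewrite count_cat !count_mem_mset msetE2.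
Qed.

Lemma big_mset_sum (V : nmodType) (I : Type) (r : seq I) (X : I -> {mset K})
    (F : K -> V) :
  \sum_(x <- \big[@msetD _/mset0]_(i <- r) X i) F x =
  \sum_(i <- r) \sum_(x <- X i) F x.
Proof.
elim: r => [|i r ih]; first by rewrite !big_nil enum_mset0 big_nil.
by rewrite !big_cons (perm_big _ (perm_msetD _ _)) big_cat/= ih.
Qed.

Lemma mem_mset_sum (I : eqType) (r : seq I) (X : I -> {mset K}) x :
  x \in \big[@msetD _/mset0]_(i <- r) X i -> exists2 i, i \in r & x \in X i.
Proof.
elim: r => [|i r ih]; first by rewrite big_nil in_mset0.
rewrite big_cons in_msetD => /orP[xi|/ih[j jr xj]].
  by exists i => //; exact: mem_head.
by exists j => //; rewrite in_cons jr orbT.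
Qed.

Lemma size_mset_sum (I : Type) (r : seq I) (X : I -> {mset K}) :
  size (\big[@msetD _/mset0]_(i <- r) X i) = (\sum_(i <- r) size (X i))%N.
Proof.
rewrite -sum1_size (big_mset_sum r X (fun=> 1%N : nat)).
by apply: eq_bigr => i _; rewrite sum1_size.
Qed.

End multisets.

(** * Pulling polynomials back along an isometry *)

Section fusion.
Variable R : realType.

Lemma enorm_sqr n (v : 'I_n -> R) : enorm v ^+ 2 = \sum_i v i ^+ 2.
Proof. by rewrite sqr_sqrtr//; apply: sumr_ge0 => i _; exact: sqr_ge0. Qed.

Lemma dotpp n (u : 'rV[R]_n) : dotp u u = enorm (u 0) ^+ 2.
Proof. by rewrite enorm_sqr; apply: eq_bigr => i _; rewrite expr2. Qed.

Section pullback.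
Variables (k d : nat) (f : 'Hom('rV[R]_k, 'rV[R]_d)).

Definition pullback (p : mpoly d R) : mpoly k R :=
  comp_mpoly [tuple lform (fun i => f (delta_mx 0 i) 0 j) | j < d] p.

Lemma meval_pullback (u : 'rV[R]_k) p :
  meval (u 0) (pullback p) = meval (f u 0) p.
Proof.
rewrite /pullback comp_mpoly_meval; apply: meval_eq => j.
rewrite tnth_mktuple meval_lform [in RHS](row_sum_delta u) linear_sum summxE.
by apply: eq_bigr => i _; rewrite linearZ mxE mulrC.
Qed.

Lemma pullback_dhomog (m : multinom d) :
  pullback (mpolyX R m) \is ishomog1 (mdeg m) mdeg.
Proof.
rewrite /pullback comp_mpolyX mdegE.
apply: (big_ind2 (fun p e => p \is ishomog1 e mdeg)).
- exact: dhomog1.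
- by move=> p e q e'; exact: dhomogM.
- move=> j _; rewrite -[X in ishomog1 X _]mul1n; apply: dhomogMn.
  rewrite tnth_mktuple; apply: rpred_sum => i _; apply: rpredZ.
  by rewrite dhomogX; apply/eqP; exact: mdeg1.
Qed.

Lemma pullback_is_linear : linear pullback.
Proof. by move=> c p q; rewrite /pullback linearP. Qed.

Hypothesis f_iso : linear_isometry f.

Lemma isometry_dotp u v : dotp (f u) (f v) = dotp u v.
Proof.
have E n (x y : 'rV[R]_n) :
    dotp (x + y) (x + y) = dotp x x + dotp y y + dotp x y *+ 2.
  by rewrite linearD/= ![dotp (x + y) _]dotpC !linearD/= (dotpC y x); ring.
have fE x : dotp (f x) (f x) = dotp x x by rewrite !dotpp f_iso.
have := fE (u + v); rewrite linearD !E !fE => /addrI /eqP.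
by rewrite eqrMn2r// => /eqP.
Qed.

Definition pullback_vector (y : 'rV[R]_d) : 'rV[R]_k :=
  \row_i dotp y (f (delta_mx 0 i)).

Lemma dotp_pullback_vector y u : dotp (pullback_vector y) u = dotp y (f u).
Proof.
rewrite [in RHS](row_sum_delta u) !linear_sum/=; apply: eq_bigr => i _.
by rewrite mxE !linearZ/= mulrC.
Qed.

(** [pullback_vector] is the adjoint of f; f after its adjoint is the orthogonal
projection on the image, as f is an isometry. *)
Lemma orthoproj_limg y : orthoproj (limg f) y = f (pullback_vector y).
Proof.
apply/esym/orthoprojP; split; first exact: memv_img (memvf _).
move=> _ /memv_imgP[u _ ->].
by rewrite linearB/= isometry_dotp dotpC (dotpC u) dotp_pullback_vector subrr.
Qed.

Lemma enorm_pullback_vector y :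
  enorm (pullback_vector y 0) = enorm (orthoproj (limg f) y 0).
Proof. by rewrite orthoproj_limg f_iso. Qed.

Lemma sphere_mean_pullback_power t c (y : 'rV[R]_d) :
  (forall w : 'I_k -> R,
    sphere_mean (lform w ^+ (2 * t)) = c * (\sum_i w i ^+ 2) ^+ t) ->
  sphere_mean (pullback (lform (y 0) ^+ (2 * t))) =
    c * enorm (orthoproj (limg f) y 0) ^+ (2 * t).
Proof.
move=> cE; rewrite -enorm_pullback_vector [enorm _ ^+ _]exprM enorm_sqr -cE.
apply: eq_sphere_mean => v _.
have -> : v = (\row_i v i) 0 by apply/funext => i; rewrite mxE.
rewrite meval_pullback !rmorphXn/= !meval_lform; congr (_ ^+ _).
exact/esym/dotp_pullback_vector.
Qed.

Lemma eq_sphere_mean_pullback (p q : mpoly d R) :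
  (forall v, enorm v = 1 -> meval v p = meval v q) ->
  sphere_mean (pullback p) = sphere_mean (pullback q).
Proof.
move=> pq; apply: eq_sphere_mean => v v1.
have vE : v = (\row_i v i) 0 by apply/funext => i; rewrite mxE.
by rewrite vE !meval_pullback pq// f_iso -vE.
Qed.

End pullback.

(** * Cubature by the unit spheres of a tight fusion frame *)

Definition sqnorm n : mpoly n R := \sum_i mvar i ^+ 2.

Lemma meval_sqnorm n (v : 'I_n -> R) : meval v (sqnorm n) = enorm v ^+ 2.
Proof.
rewrite enorm_sqr raddf_sum/=; apply: eq_bigr => i _.
by rewrite rmorphXn/= mevalXU.
Qed.

Lemma sqnorm_dhomog n t : sqnorm n ^+ t \is ishomog1 (2 * t) mdeg.
Proof.
apply: dhomogMn; apply: rpred_sum => i _.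
apply: (@dhomogMn _ _ _ 1%N _ 2).
by rewrite dhomogX; apply/eqP; exact: mdeg1.
Qed.

(** The design property of the spheres S(V), averaged over the frame.  In odd
degree both sides vanish; in even degree at most 2t, multiplication by a power
of |x|^2 reduces to degree 2t, where both sides are determined up to a factor
by the powers of linear forms, and the frame identity enters. *)
Lemma fusion_frame_cubature d k t (D : {fset {vspace 'rV[R]_d}})
    (f : {vspace 'rV[R]_d} -> 'Hom('rV[R]_k, 'rV[R]_d)) (m : multinom d) :
  (0 < k)%N -> (0 < d)%N -> tight_fusion_frame k t D ->
  (forall V, V \in D -> linear_isometry (f V) /\ limg (f V) = V) ->
  (mdeg m <= (2 * t).+1)%N ->
  \sum_(V <- D) sphere_mean (pullback (f V) (mpolyX R m)) =
    (size D)%:R * sphere_mean (mpolyX R m).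
Proof.
move=> k0 d0 [_ [A _ DA]] fD mt.
have [om|em] := boolP (odd (mdeg m)).
  rewrite (sphere_mean_odd d0 om) ?dhomogX// mulr0 big1// => V _.
  by apply: (sphere_mean_odd k0 om); exact: pullback_dhomog.
have mj : mdeg m = (2 * (mdeg m)./2)%N.
  by rewrite mul2n -[LHS]odd_double_half (negbTE em).
set j := (mdeg m)./2 in mj.
have jt : (j <= t)%N.
  move: mt; rewrite mj leq_eqVlt ltnS leq_pmul2l//.
  move=> /orP[/eqP/(congr1 odd)|//].
  by rewrite /= !oddM.
(* The two functionals to be compared in degree 2t are L1 and the mean over
   the big sphere; q = |x|^(2(t-j)) X^m has degree 2t and agrees with X^m on
   unit vectors. *)
pose L1 q := \sum_(V <- D) sphere_mean (pullback (f V) q).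
have L1lin : scalar L1.
  move=> c p q; rewrite /L1 mulr_sumr -big_split/=; apply: eq_bigr => V _.
  by rewrite pullback_is_linear (sphere_mean_is_scalar k0).
pose L1' : {scalar mpoly d R} :=
  HB.pack L1 (GRing.isLinear.Build _ _ _ _ L1 L1lin).
have [ck ckE] := sphere_mean_even_power R t k0.
have [cd cdE] := sphere_mean_even_power R t d0.
have norm1 v e : enorm v = 1 -> meval v (sqnorm d ^+ e) = 1.
  by move=> v1; rewrite rmorphXn/= meval_sqnorm v1 !expr1n.
have L1E p q : (forall v, enorm v = 1 -> meval v p = meval v q) -> L1 p = L1 q.
  move=> pq; apply: eq_big_seq => V VD.
  by apply: eq_sphere_mean_pullback => //; case: (fD V VD).
have L1n : L1 (sqnorm d ^+ t) = (size D)%:R.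
  rewrite (L1E _ 1) => [|v v1]; last by rewrite norm1// meval1.
  rewrite /L1 -sum1_size natr_sum; apply: eq_bigr => V _.
  by rewrite /pullback comp_mpoly1 sphere_mean1.
have L2n : sphere_mean (sqnorm d ^+ t) = 1.
  rewrite (@eq_sphere_mean _ _ _ 1) ?sphere_mean1// => v v1.
  by rewrite norm1// meval1.
have h := @scalar_proportional R d L1' (sphere_mean_scalar R d0) (2 * t)
  (fun y => (\sum_i y i ^+ 2) ^+ t) (ck * A) cd (sqnorm d ^+ t) _ cdE
  (sqnorm_dhomog d t) L2n (sqnorm d ^+ (t - j) * mpolyX R m) _.
have mE v : enorm v = 1 ->
    meval v (sqnorm d ^+ (t - j) * mpolyX R m) = meval v (mpolyX R m).
  by move=> v1; rewrite mevalM norm1// mul1r.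
rewrite -L1n -(eq_sphere_mean mE) -[LHS]/(L1 _) -(L1E _ _ mE).
apply: h => [y|].
  have yE : y = (\row_i y i) 0 by apply/funext => i; rewrite mxE.
  rewrite -enorm_sqr -exprM -mulrA yE -DA mulr_sumr.
  apply: eq_big_seq => V VD; have [fi fV] := fD V VD.
  by rewrite (sphere_mean_pullback_power fi _ ckE) fV.
have -> : (2 * t = 2 * (t - j) + mdeg m)%N by rewrite mj -mulnDr subnK.
by apply: dhomogM; [exact: sqnorm_dhomog|rewrite dhomogX].
Qed.

(** * Designs *)

Definition multiset_mean n (X : {mset 'rV[R]_n}%mset) (p : mpoly n R) : R :=
  (size X)%:R^-1 * \sum_(x <- X) meval (x 0) p.

Lemma multiset_mean_is_scalar n (X : {mset 'rV[R]_n}%mset) :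
  scalar (multiset_mean X).
Proof.
move=> c p q; rewrite /multiset_mean mulrCA -mulrDr; congr (_ * _).
rewrite mulr_sumr -big_split/=; apply: eq_bigr => x _.
by rewrite mevalD mevalZ.
Qed.

Lemma spherical_design_mpolyX n s (X : {mset 'rV[R]_n}%mset) : (0 < n)%N ->
  (0 < size X)%N -> (forall x, x \in X -> enorm (x 0) = 1) ->
  (forall m : multinom n, (mdeg m <= s)%N ->
    sphere_mean (mpolyX R m) = multiset_mean X (mpolyX R m)) ->
  spherical_design s X.
Proof.
move=> n0 X0 X1 Xm; split => // p ps.
pose L : {scalar mpoly n R} := HB.pack (multiset_mean X)
  (GRing.isLinear.Build _ _ _ _ (multiset_mean X) (multiset_mean_is_scalar X)).
apply: (@eq_scalar_msupp _ _ (sphere_mean_scalar R n0) L) => m mp.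
by apply: Xm; rewrite -ltnS; apply: leq_trans ps; exact: msize_mdeg_lt.
Qed.

Lemma size_mset_of_fset (K : choiceType) (A : {fset K}) :
  size (mset_of_fset A) = #|` A|.
Proof. exact: perm_size (perm_eq_seq_mset _). Qed.

(** Otherwise the frame identity at a unit vector would give A = 0. *)
Lemma tight_fusion_frame_neq0 d k t (D : {fset {vspace 'rV[R]_d}}) :
  (0 < d)%N -> tight_fusion_frame k t D -> D != fset0.
Proof.
case: d D => // d D _ [_ [A A0 DA]]; apply/eqP => D0.
have := DA (delta_mx 0 0); rewrite D0 big_nil [enorm _](_ : _ = 1) ?expr1n.
  by rewrite mulr1 => A00; rewrite -A00 ltxx in A0.
rewrite /enorm big_ord_recl big1 => [|i _]; last by rewrite mxE expr0n.
by rewrite mxE !eqxx expr1n addr0 sqrtr1.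
Qed.

End fusion.

Unset Implicit Arguments.

Theorem corollary3p3 (R : realType) (d k t s : nat)
    (D : {fset {vspace 'rV[R]_d}})
    (Y : {vspace 'rV[R]_d} -> {fset 'rV[R]_d}) :
  (1 <= k <= d)%N -> (1 <= t)%N -> (1 <= s)%N ->
  tight_fusion_frame k t D ->
  (forall V, V \in D -> subspace_design k s V (mset_of_fset (Y V))) ->
  (forall V W, V \in D -> W \in D -> #|` Y V| = #|` Y W|) ->
  spherical_design (minn s (2 * t).+1)
    (\big[@msetD _/mset0]_(V <- D) mset_of_fset (Y V)).
Proof.
move=> /andP[k0 kd] _ _ frame design card_eq.
have d0 : (0 < d)%N by exact: leq_trans kd.
have /choice[f fP] : forall V : {vspace 'rV[R]_d},
    exists f : 'Hom('rV[R]_k, 'rV[R]_d), V \in D ->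
    [/\ linear_isometry f, limg f = V
      & exists2 X : {mset 'rV[R]_k}%mset, spherical_design s X &
          mset_of_fset (Y V) = seq_mset [seq f u | u <- X]].
  move=> V; have [VD|_] := boolP (V \in D); last by exists 0.
  by have [f fP] := design V VD; exists f.
have Dn0 := tight_fusion_frame_neq0 d0 frame.
have D0 : (0 < size D)%N by rewrite -cardfs_gt0 in Dn0.
have /fset0Pn[V0 V0D] := Dn0.
set N := #|` Y V0|.
have size_Y V : V \in D -> size (mset_of_fset (Y V)) = N.
  by move=> VD; rewrite size_mset_of_fset; exact: card_eq.
have N0 : (0 < N)%N.
  have [_ _ [X [X0 _ _] YX]] := fP V0 V0D.
  by rewrite -(size_Y V0 V0D) YX (perm_size (perm_eq_seq_mset _)) size_map.
set Z := (\big[_/_]_(V <- D) _).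
have size_Z : size Z = (size D * N)%N.
  rewrite size_mset_sum (eq_big_seq (fun=> N))// big_const_seq count_predT.
  by rewrite iter_addn_0 mulnC.
apply: spherical_design_mpolyX => //.
- by rewrite size_Z muln_gt0 D0.
- move=> x /mem_mset_sum[V VD].
  have [fi _ [X [_ X1 _] ->]] := fP V VD.
  by rewrite (perm_mem (perm_eq_seq_mset _)) => /mapP[u uX ->]; rewrite fi X1.
move=> m; rewrite leq_min => /andP[ms mt].
rewrite /multiset_mean size_Z big_mset_sum natrM.
rewrite (eq_big_seq
    (fun V => N%:R * sphere_mean (pullback (f V) (mpolyX R m)))).
  rewrite -mulr_sumr (fusion_frame_cubature k0 d0 frame _ mt).
    rewrite [N%:R * (_ * _)]mulrA [N%:R * _]mulrC mulKf//.
    by rewrite mulf_neq0// pnatr_eq0 -lt0n.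
  by move=> V VD; have [] := fP V VD.
move=> V VD; have [fi _ [X [X0 _ XE] YX]] := fP V VD.
have size_X : size X = N.
  by rewrite -(size_Y V VD) YX (perm_size (perm_eq_seq_mset _)) size_map.
have -> : sphere_mean (pullback (f V) (mpolyX R m)) =
    (size X)%:R^-1 * \sum_(u <- X) meval (u 0) (pullback (f V) (mpolyX R m)).
  by apply: XE; apply: leq_trans (msize_dhomog (pullback_dhomog _ _)) _.
rewrite size_X mulrA mulfV ?mul1r ?pnatr_eq0 -?lt0n// YX.
rewrite (perm_big _ (perm_eq_seq_mset _)) big_map.
by apply: eq_bigr => u _; rewrite meval_pullback.
Qed.
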